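(* Let $\mathscr{D}=(\mathscr{P},\mathscr{B})$ be a $2$-$(v,k,\lambda)$ design and let $G\le \mathrm{Aut}(\mathscr{D})$ be transitive on $\mathscr{B}$. Suppose $v=cd$ with integers $c\ge 2$, $d\ge 2$, and that $G$ leaves invariant a partition $\mathscr{C}$ of $\mathscr{P}$ into $d$ classes each of size $c$. Let $(m,n)$ be the Delandtsheer--Doyen parameters of $\mathscr{D}$ relative to $G$ and $\mathscr{C}$. Let $C\in\mathscr{C}$, let $H=G_C^C$ be the permutation group induced on $C$ by the setwise stabiliser $G_C$, and let $K=G^{\mathscr{C}}$ be the permutation group induced by $G$ on $\mathscr{C}$. Then \[\frac{\mathrm{Rank}(H)-1}{2}\le \mathrm{PairRank}(H)\le n \quad\text{and}\quad \frac{\mathrm{Rank}(K)-1}{2}\le \mathrm{PairRank}(K)\le m.\]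
   Context: A $2$-$(v,k,\lambda)$ design has $v$ points, blocks which are $k$-subsets, and every pair of distinct points lies in exactly $\lambda$ blocks. For a partition $\mathscr{C}$ of the points, an unordered pair of distinct points is an inner pair if both points lie in the same class and an outer pair otherwise. Delandtsheer and Doyen proved that in the situation above there are positive integers $m,n$ with $c=(\binom{k}{2}-n)/m$ and $d=(\binom{k}{2}-m)/n$, where $n$ is the number of inner pairs contained in a block and $mc$ is the number of outer pairs contained in a block (these numbers are independent of the block by block-transitivity); $(m,n)$ are called the Delandtsheer--Doyen parameters. For a transitive permutation group $X$ on $\Omega$, $\mathrm{Rank}(X)$ is the number of orbits of a point stabiliser $X_\alpha$ on $\Omega$ (equivalently the number of $X$-orbits on $\Omega\times\Omega$), and $\mathrm{PairRank}(X)$ is the number of $X$-orbits on unordered pairs of distinct points of $\Omega$. *)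

(* Defs.v *)
From mathcomp Require Import all_boot all_order all_fingroup all_algebra.

Set Implicit Arguments.
Unset Strict Implicit.
Unset Printing Implicit Defensive.

Import GroupScope.

Record two_design (T : finType) (B : {set {set T}}) (v k lambda : nat) : Prop :=
  TwoDesign {
    design_points : #|T| = v;
    design_blocks : forall b, b \in B -> #|b| = k;
    design_pairs : forall x y : T, x != y ->
      #|[set b in B | (x \in b) && (y \in b)]| = lambda
  }.

Definition design_aut (T : finType) (B : {set {set T}}) : {group {perm T}} :=
  'N(B | 'P^* )%G.

Definition upairs (T : finType) (S : {set T}) : {set {set T}} :=
  [set p : {set T} | (p \subset S) && (#|p| == 2)].

Definition inner_pairs (T : finType) (P : {set {set T}}) (b : {set T}) :
    {set {set T}} :=
  [set p in upairs b | [exists C in P, p \subset (C : {set T})]].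

Definition outer_pairs (T : finType) (P : {set {set T}}) (b : {set T}) :
    {set {set T}} :=
  [set p in upairs b | ~~ [exists C in P, p \subset (C : {set T})]].

Record DD_parameters (T : finType) (B P : {set {set T}}) (k c d m n : nat) :
    Prop :=
  DDParameters {
    DD_m_gt0 : 0 < m;
    DD_n_gt0 : 0 < n;
    DD_c : (c%:R = ('C(k, 2)%:R - n%:R) / m%:R :> rat)%R;
    DD_d : (d%:R = ('C(k, 2)%:R - m%:R) / n%:R :> rat)%R;
    DD_inner : forall b, b \in B -> #|inner_pairs P b| = n;
    DD_outer : forall b, b \in B -> #|outer_pairs P b| = (m * c)%N
  }.

(* A permutation group on a subset S of T is represented, as usual with        *)
(* restr_perm, by permutations of T that fix every point outside S.            *)
Definition class_group (T : finType) (G : {group {perm T}}) (C : {set T}) :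
    {group {perm T}} :=
  (restr_perm C @* 'N_G(C | 'P))%G.

Definition partition_group (T : finType) (G : {group {perm T}})
    (P : {set {set T}}) : {group {perm {set T}}} :=
  (restr_perm P @* (actperm 'P^* @* G))%G.

(* The number of orbits on S of the stabiliser of x; for X transitive on S it  *)
(* does not depend on the choice of x in S.                                    *)
Definition perm_rank (T : finType) (X : {group {perm T}}) (S : {set T})
    (x : T) : nat :=
  #|orbit 'P 'C_X[x | 'P] @: S|.

Definition pair_rank (T : finType) (X : {group {perm T}}) (S : {set T}) : nat :=
  #|orbit 'P^* X @: upairs S|.

(* Main.v *)
(* Two pairs inside a class C that are equivalent under G are equivalent under
   G_C, and every inner pair can be moved by G into a fixed block b, so the
   orbits of H on pairs number at most the n inner pairs of b.  For an orbit O of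
   K on pairs of classes, double counting shows that the number of pairs of b
   lying over O is a positive multiple of c (or at least c when k = v); these
   sets are disjoint subsets of the m c outer pairs of b, whence at most m orbits.
   The multiple-of-c claim needs K transitive; this follows from an elementary
   form of Block's lemma: when k < v, a nonempty proper G-invariant point set
   meeting every block in s points would make the pair counts within it, within
   its complement and overall incompatible. *)

Require Import Defs.
From mathcomp Require Import all_boot all_order all_fingroup all_algebra.
From mathcomp Require Import zify.

Set Implicit Arguments.
Unset Strict Implicit.
Unset Printing Implicit Defensive.

(** * Counting tools, and permutations acting on unordered pairs *)

(** Count the related pairs: there is at least one for each element of [A] and at most [N] for each
    element of [B]. *)
Lemma leq_card_rel (I J : finType) (A : {set I}) (B : {set J})
    (R : I -> J -> bool) (N : nat) :
    (forall i, i \in A -> exists2 j, j \in B & R i j) ->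
    (forall j, j \in B -> #|[set i in A | R i j]| <= N) ->
  #|A| <= N * #|B|.
Proof.
move=> hA hB; rewrite -sum1_card.
apply: (@leq_trans (\sum_(i in A) \sum_(j in B) R i j)).
  apply: leq_sum => i /hA[j jB Rij].
  by rewrite (bigD1 j) //= Rij.
rewrite exchange_big /= mulnC -sum_nat_const; apply: leq_sum => j /hB.
apply: leq_trans; rewrite -sum1_card.
rewrite [leqRHS](eq_bigl (fun i => (i \in A) && R i j)) => [|i].
  by rewrite big_mkcondr.
by rewrite inE.
Qed.

Lemma setactPE (T : finType) (g : {perm T}) (S : {set T}) :
  ('P^* S g)%act = g @: S.
Proof. exact: eq_imset. Qed.

Lemma imset_permSS (T : finType) (g : {perm T}) (A S : {set T}) :
  (g @: A \subset g @: S) = (A \subset S).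
Proof.
apply/idP/idP => [/subsetP sub|]; last exact: imsetS.
by apply/subsetP=> x /(imset_f g)/sub; rewrite mem_imset //; apply: perm_inj.
Qed.

Lemma setact_set2 (T : finType) (g : {perm T}) (x y : T) :
  ('P^* [set x; y] g)%act = [set g x; g y].
Proof. by rewrite setactPE imsetU1 imset_set1. Qed.

Lemma set2_eq (T : finType) (x y z t : T) :
  x != y -> [set x; y] = [set z; t] -> (x = z /\ y = t) \/ (x = t /\ y = z).
Proof.
move=> xy E; have := set21 x y; have := set22 x y; rewrite E.
by move=> /set2P[] yE /set2P[] xE; auto; rewrite xE yE eqxx in xy.
Qed.

Lemma upairs_set2 (T : finType) (S : {set T}) (x y : T) :
  x \in S -> y \in S -> x != y -> [set x; y] \in upairs S.
Proof.
by move=> xS yS xy; rewrite !inE cards2 xy eqxx andbT; apply/subsetP=> z /set2P[]->.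
Qed.

Lemma upairsP (T : finType) (S p : {set T}) :
  reflect (exists x y, [/\ x \in S, y \in S, x != y & p = [set x; y]])
          (p \in upairs S).
Proof.
apply: (iffP idP) => [|[x [y [xS yS xy ->]]]]; last exact: upairs_set2.
rewrite inE => /andP[sub /cards2P[x [y [xy def]]]]; exists x, y; split=> //;
  by apply: (subsetP sub); rewrite def !inE eqxx ?orbT.
Qed.

Lemma card_upairs (T : finType) (S : {set T}) : #|upairs S| = 'C(#|S|, 2).
Proof. exact: cards_draws. Qed.

(* If {x, y}, {x, z}, {x, t} are equivalent under X, then two of y, z, t lie in
   the same orbit of the stabiliser of x. *)
Lemma perm_rank_leq (T : finType) (X : {group {perm T}}) (S : {set T}) (x : T) :
  x \in S -> perm_rank X S x <= (2 * pair_rank X S).+1.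
Proof.
move=> xS; rewrite /perm_rank /pair_rank; set f := orbit 'P 'C_X[x | 'P].
(* The extra 1 pays for the orbit of [x] itself; the remaining orbits are related to orbits on
   pairs, at most two to each. *)
rewrite -{1}(setD1K xS) imsetU1 cardsU1 -[(_ * _).+1]add1n leq_add ?leq_b1 //.
pose R (A : {set T}) (O : {set {set T}}) :=
  [exists y in S :\ x, (A == f y) && ([set x; y] \in O)].
apply: (@leq_card_rel _ _ _ _ R) => [A /imsetP[y yS ->]|O /imsetP[p pS ->]].
  have [/eqP xy yS'] := setD1P yS.
  exists (orbit 'P^* X [set x; y]); last first.
    by apply/existsP; exists y; rewrite yS eqxx orbit_refl.
  by apply/imset_f/upairs_set2 => //; apply/eqP=> /esym.
have fE y g : g \in X -> g x = x -> f (g y) = f y.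
  move=> gX gx; apply/orbit_eqP/orbitP; exists g => //.
  by rewrite inE gX; apply/astab1P.
have key y z t : y != x -> [set x; y] \in orbit 'P^* X p ->
    [set x; z] \in orbit 'P^* X p -> [set x; t] \in orbit 'P^* X p ->
    [|| f y == f z, f y == f t | f z == f t].
  move=> yx /orbit_eqP <- /orbitP[g gX].
  rewrite setact_set2 => gE /orbitP[h hX]; rewrite setact_set2 => hE.
  have img (k : {perm T}) : k x != k y by rewrite (inj_eq perm_inj) eq_sym.
  case: (set2_eq (img g) gE) => [[gx <-]|[gx gy]]; first by rewrite fE // eqxx.
  case: (set2_eq (img h) hE) => [[hx <-]|[hx hy]]; first by rewrite fE // eqxx orbT.
  (* Here [g] and [h] both send [y] to [x], so [g^-1 * h] fixes [x] and takes [z] to [t]. *)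
  have -> : t = (g^-1 * h)%g z by rewrite permM -gx permK hx.
  rewrite fE ?eqxx ?orbT ?groupM ?groupV //.
  by rewrite permM -{1}gy permK hy.
rewrite leqNgt; apply/card_gt2P => -[A1 [A2 [A3 [[]]]]].
rewrite !inE => /andP[_ /existsP[y /and3P[]]] + /eqP-> Oy.
move=> + /andP[_ /existsP[z /and3P[_ /eqP-> Oz]]].
move=> + /andP[_ /existsP[t /and3P[_ /eqP-> Ot]]] [yz zt ty].
rewrite !inE => /andP[yx _].
by have := key y z t yx Oy Oz Ot; rewrite (negPf yz) (negPf zt) eq_sym (negPf ty).
Qed.

(** * Double counting over blocks, and transitivity on points *)

(** Count the incidences between pairs of [F] and blocks. Each pair lies in [lambda] blocks, and
    since [F] is invariant and [G] is transitive on blocks, every block contains as many pairs of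
    [F] as [b]. *)
Lemma double_count (T : finType) (B : {set {set T}}) (v k lambda : nat)
    (G : {group {perm T}}) (F : {set {set T}}) (b : {set T}) :
    two_design B v k lambda -> [transitive G, on B | 'P^*] ->
    F \subset upairs [set: T] -> [acts G, on F | 'P^*] -> b \in B ->
  #|F| * lambda = #|B| * #|[set p in F | p \subset b]|.
Proof.
move=> hD hGB FU hGF bB.
transitivity (\sum_(p in F) \sum_(a in B) (p \subset a : nat)).
  rewrite -sum_nat_const; apply: eq_bigr => p /(subsetP FU)/upairsP.
  move=> [x [y [_ _ xy ->]]]; rewrite -(design_pairs hD xy) -sum1_card.
  rewrite (eq_bigl (fun a => (a \in B) && ([set x; y] \subset a))) => [|a].
    by rewrite big_mkcondr.
  by rewrite inE subUset !sub1set.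
rewrite exchange_big /= -sum_nat_const; apply: eq_bigr => a aB.
have [g gG ->] := atransP2 hGB bB aB.
rewrite -sum1_card [RHS](eq_bigl (fun p => (p \in F) && (p \subset b))) => [|p].
  rewrite [RHS]big_mkcondr (reindex_inj (act_inj 'P^* g)) /=.
  apply: eq_big => [p|p _]; first by rewrite (acts_act hGF).
  by rewrite !setactPE imset_permSS.
by rewrite inE.
Qed.

(** Think of [x], [y] as the sizes of two complementary invariant point sets, [s], [t] as the sizes
    of their traces on a block, [l] as the pair multiplicity and [b] as the number of blocks.
    Subtracting the first two counts from the third leaves [x * y * l = b * (s * t)]. Comparing this
    with each of the first two gives [(x - 1) * t = y * (s - 1)] and [(y - 1) * s = x * (t - 1)];
    their sum yields [x + y = s + t]. *)
Lemma pair_counts_rigid (x y s t l b : nat) :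
    0 < x -> 0 < y -> 0 < l -> 0 < b ->
    'C(x, 2) * l = b * 'C(s, 2) -> 'C(y, 2) * l = b * 'C(t, 2) ->
    'C(x + y, 2) * l = b * 'C(s + t, 2) ->
  x + y <= s + t.
Proof.
move=> x0 y0 l0 b0 cx cy cxy.
have bin2D u w : 'C(u + w, 2) = 'C(u, 2) + 'C(w, 2) + u * w.
  elim: u => [|u IH]; first by rewrite bin0n add0n mul0n addn0.
  by rewrite addSn !binS !bin1 IH; lia.
have cross : x * y * l = b * (s * t) by rewrite !bin2D in cxy; nia.
have st0 : 0 < s * t.
  have : 0 < x * y * l by rewrite !muln_gt0 x0 y0 l0.
  by rewrite cross muln_gt0 => /andP[].
have [s0 t0] : 0 < s /\ 0 < t by apply/andP; rewrite -muln_gt0.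
have bin2E u : u.+1 * u = 'C(u.+1, 2) * 2.
  by have := mul_bin_diag u.+1 1; rewrite bin1; lia.
(* The quotient of the two equations, with denominators cleared. *)
have step u w p q : 0 < u -> 0 < p -> 'C(u, 2) * l = b * 'C(p, 2) ->
    u * w * l = b * (p * q) -> u.-1 * q = w * p.-1.
  case: u p => // u [] // p _ _ c1 c2 /=.
  apply/eqP; rewrite -(@eqn_pmul2l (u.+1 * l * (b * p.+1))); last first.
    by rewrite !muln_gt0 l0 b0.
  apply/eqP.
  transitivity (u.+1 * u * l * (b * (p.+1 * q))); first by lia.
  transitivity (u.+1 * w * l * (b * (p.+1 * p))); last by lia.
  by rewrite -c2 !bin2E [_ * 2 * l]mulnAC c1; lia.
have e1 := step x y s t x0 s0 cx cross.
have e2 : y.-1 * s = x * t.-1 by apply: step => //; lia.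
by nia.
Qed.

(** If the orbit [X] of [x] had a nonempty complement [Y], the pair counts of [X], of [Y] and of the
    whole point set would force [v <= k] by [pair_counts_rigid]. *)
Lemma block_transitive_imp_point_transitive (T : finType) (B : {set {set T}})
    (v k lambda : nat) (G : {group {perm T}}) :
    two_design B v k lambda -> [transitive G, on B | 'P^*] ->
    0 < lambda -> k < v ->
  forall x y : T, exists2 g, g \in G & y = g x.
Proof.
move=> hD hGB lam_gt0 ltkv x y.
have [b bB _] := imsetP hGB.
pose X : {set T} := orbit 'P G x; pose Y := ~: X.
have invX g z : g \in G -> (g z \in X) = (z \in X).
  by move=> gG; have /= <- := acts_act (acts_orbit 'P x (subsetT G)) gG z.
(* This is [double_count] for the pairs inside an invariant point set. *)
have count (S : {set T}) : (forall g z, g \in G -> (g z \in S) = (z \in S)) ->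
    'C(#|S|, 2) * lambda = #|B| * 'C(#|S :&: b|, 2).
  move=> invS.
  have FE : [set p in upairs S | p \subset b] = upairs (S :&: b).
    by apply/setP=> p; rewrite !inE subsetI andbAC.
  rewrite -!card_upairs -FE; apply: (double_count hD hGB) => //.
    by apply/subsetP=> p; rewrite !inE subsetT => /andP[].
  apply/actsP=> g gG p /=; rewrite !inE setactPE card_imset; last exact: perm_inj.
  congr (_ && _); rewrite -[S in LHS](_ : g @: S = S) ?imset_permSS //.
  apply/eqP; rewrite eqEcard card_imset; last exact: perm_inj.
  by rewrite leqnn andbT; apply/subsetP=> _ /imsetP[z zS ->]; rewrite invS.
have cT : 'C(v, 2) * lambda = #|B| * 'C(k, 2).
  rewrite -(design_points hD) -cardsT -(design_blocks hD bB) -[b in RHS]setTI.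
  by apply: count => g z _; rewrite !inE.
have cX := count X invX.
have cY : 'C(#|Y|, 2) * lambda = #|B| * 'C(#|Y :&: b|, 2).
  by apply: count => g z gG; rewrite !in_setC invX.
have X_gt0 : 0 < #|X| by apply/card_gt0P; exists x; apply: orbit_refl.
have XYv : #|X| + #|Y| = v by rewrite cardsC (design_points hD).
have XYk : #|X :&: b| + #|Y :&: b| = k.
  by rewrite -(design_blocks hD bB) -(cardsID X b) setIC setDE [Y :&: b]setIC.
have B_gt0 : 0 < #|B| by apply/card_gt0P; exists b.
suff Y0 : #|Y| = 0.
  have : y \in X by apply/negPn; rewrite -in_setC -/Y (cards0_eq Y0) inE.
  by case/orbitP=> g gG <-; exists g.
apply/eqP; rewrite -leqn0 leqNgt; apply/negP=> Y_gt0.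
move: ltkv; rewrite ltnNge -XYv -XYk => /negP; apply.
by apply: (@pair_counts_rigid _ _ _ _ lambda #|B|); rewrite ?XYv ?XYk.
Qed.

(** * The induced groups, and the bound by inner pairs *)

Lemma partition_groupP (T : finType) (G : {group {perm T}}) (P : {set {set T}})
    (g : {perm T}) :
    [acts G, on P | 'P^*] -> g \in G ->
  exists2 h, h \in partition_group G P & forall D, D \in P -> h D = g @: D.
Proof.
move=> hGP gG.
have nP : actperm 'P^* g \in 'N(P | 'P)%g.
  apply/astabsP=> D /=; rewrite apermE actpermE.
  exact: (acts_act hGP gG).
exists (restr_perm P (actperm 'P^* g)); last first.
  by move=> D DP; rewrite restr_permE // actpermE /= setactPE.
by apply: (mem_morphim _ nP); apply: mem_morphim; rewrite ?inE.
Qed.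

(** An element of [G] that carries a pair of [C] to a pair of [C] maps [C] to a class meeting [C],
    hence to [C] itself, so it restricts to an element of [class_group G C]. *)
Lemma class_group_orbit (T : finType) (G : {group {perm T}}) (P : {set {set T}})
    (C q : {set T}) :
    partition P [set: T] -> [acts G, on P | 'P^*] -> C \in P ->
    q \in upairs C ->
  orbit 'P^* (class_group G C) q = upairs C :&: orbit 'P^* G q.
Proof.
move=> hP hGP CP qC; apply/setP=> p; apply/idP/idP.
  case/orbitP=> h /morphimP[g gN /setIP[gG _] ->] <-.
  have -> : ('P^* q (restr_perm C g) = 'P^* q g)%act.
    rewrite /= !setactPE; apply: eq_in_imset => x xq; apply: restr_permE => //.
    by move: qC xq; rewrite inE => /andP[/subsetP sub _] /sub.
  rewrite inE mem_orbit // andbT; move: qC; rewrite !inE card_setact => /andP[sub ->].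
  by rewrite andbT /= -(astabs_setact gN) /= !setactPE imset_permSS.
case/setIP=> pC /orbitP[g gG defp].
have gC : g @: C = C.
  have /upairsP[x [y [xC yC _ defq]]] := qC.
  have gCP : g @: C \in P by rewrite -setactPE (acts_act hGP).
  have gxC : g x \in C.
    move: pC; rewrite inE -defp /= setactPE => /andP[/subsetP sub _].
    by apply/sub/imset_f; rewrite defq set21.
  have [_ tI _] := and3P hP.
  by rewrite -(def_pblock tI gCP (imset_f g xC)) (def_pblock tI CP gxC).
have gN : g \in 'N(C | 'P)%g.
  by apply/astabsP => x /=; rewrite apermE -{1}gC mem_imset //; apply: perm_inj.
apply/orbitP; exists (restr_perm C g).
  by apply: mem_morphim; rewrite // inE gG gN.
rewrite -defp /= !setactPE; apply: eq_in_imset => x xq; apply: restr_permE => //.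
by move: qC xq; rewrite inE => /andP[/subsetP sub _] /sub.
Qed.

Lemma class_pair_rank_leq (T : finType) (B : {set {set T}})
    (v k lambda : nat) (G : {group {perm T}}) (P : {set {set T}}) (C b : {set T}) :
    two_design B v k lambda -> 0 < lambda -> [transitive G, on B | 'P^*] ->
    partition P [set: T] -> [acts G, on P | 'P^*] -> C \in P -> b \in B ->
  pair_rank (class_group G C) C <= #|inner_pairs P b|.
Proof.
move=> hD lam_gt0 hGB hP hGP CP bB.
(* Every orbit on pairs of [C] is a value of this map at an inner pair of [b]: a pair [q] of [C]
   lies in some block as [lambda] is positive, and [G] moves that block to [b]. *)
apply: leq_trans (leq_imset_card (fun p => upairs C :&: orbit 'P^* G p) _).
apply/subset_leq_card/subsetP=> _ /imsetP[q qC ->].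
rewrite (class_group_orbit hP hGP CP qC).
have /upairsP[x [y [_ _ xy defq]]] := qC.
have : 0 < #|[set a in B | (x \in a) && (y \in a)]| by rewrite (design_pairs hD).
case/card_gt0P=> a; rewrite inE => /and3P[aB xa ya].
have [g gG defb] := atransP2 hGB aB bB.
rewrite -(orbit_act 'P^* q gG); apply: imset_f.
rewrite !inE card_setact defb /= !setactPE imset_permSS defq subUset !sub1set xa ya.
rewrite cards2 xy /=; apply/existsP; exists (g @: C).
rewrite -setactPE (acts_act hGP) // CP setactPE imset_permSS -defq.
by move: qC; rewrite inE => /andP[].
Qed.

(** * Outer pairs, sorted by the pair of classes they meet *)

(** Count the incidences between elements of [S] and pairs of [O]: each pair has two elements, and
    by transitivity all elements of [S] lie in equally many pairs of [O]. *)
Lemma dvdn_card_invariant_pairs (I : finType) (X : {group {perm I}}) (S : {set I})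
    (O : {set {set I}}) :
    (forall D E, D \in S -> E \in S -> exists2 h, h \in X & E = h D) ->
    O \subset upairs S -> [acts X, on O | 'P^*] ->
  #|S| %| 2 * #|O|.
Proof.
move=> trX OS actO; have [S0|[D0 D0S]] := set_0Vmem S => //.
  suff -> : O = set0 by rewrite cards0 muln0.
  apply/eqP; rewrite -subset0.
  by apply/subsetP=> q /(subsetP OS)/upairsP[x [y []]]; rewrite S0 inE.
have -> : 2 * #|O| = \sum_(q in O) \sum_(D in S) (D \in q : nat).
  rewrite mulnC -sum_nat_const; apply: eq_bigr => q /(subsetP OS).
  rewrite inE => /andP[qS /eqP <-]; rewrite -sum1_card -big_mkcondr /=.
  apply: eq_bigl => D; apply/idP/andP => [Dq|[]//].
  by split=> //; apply: (subsetP qS).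
rewrite exchange_big (eq_bigr (fun=> \sum_(q in O) (D0 \in q : nat))) => [|D DS].
  by rewrite sum_nat_const dvdn_mulr.
have [h hX ->] := trX _ _ D0S DS.
rewrite (reindex_inj (act_inj 'P^* h)) /=.
apply: eq_big => [q|q _]; first by rewrite (acts_act actO).
by rewrite setactPE mem_imset //; apply: perm_inj.
Qed.

Section ClassPairs.

Variables (T : finType) (P : {set {set T}}) (c : nat).
Hypotheses (hP : partition P [set: T])
           (hPc : forall D : {set T}, D \in P -> #|D| = c).

(** A pair inside one class is sent to a singleton, so among point pairs those with image in
    [upairs P] are outer. *)
Let class_pair (p : {set T}) := pblock P @: p.

Let in_pblock x : x \in pblock P x.
Proof. by rewrite mem_pblock (cover_partition hP) inE. Qed.

Let pblockE D x : D \in P -> x \in D -> pblock P x = D.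
Proof. by apply: def_pblock; case/and3P: hP. Qed.

Let class_pair2 x y : class_pair [set x; y] = [set pblock P x; pblock P y].
Proof. by rewrite /class_pair imsetU1 imset_set1. Qed.

Lemma class_pair_outer p b : p \in upairs b -> class_pair p \in upairs P ->
  p \in outer_pairs P b.
Proof.
move=> pb; rewrite !inE -/(upairs b) => /andP[_].
have /upairsP[x [y [xb yb xy defp]]] := pb.
move: pb; rewrite inE => ->; rewrite defp class_pair2.
apply: contraL => /existsP[D /andP[DP]]; rewrite subUset !sub1set => /andP[xD yD].
by rewrite !(pblockE DP) // setUid cards1.
Qed.

(** The pairs over two classes [D] and [E] correspond to the points of [D] times [E]; disjointness
    of the classes makes the correspondence injective. *)
Lemma card_pairs_over_class_pair q : q \in upairs P ->
  #|[set p in upairs [set: T] | class_pair p == q]| = c ^ 2.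
Proof.
move=> /upairsP[D [E [DP EP DE ->]]].
have DxE x : x \in D -> x \in E -> False.
  by move=> xD xE; rewrite -(pblockE DP xD) (pblockE EP xE) eqxx in DE.
have DxEneq x y : x \in D -> y \in E -> x != y.
  by move=> xD yE; apply: contraTneq xD => ->; apply/negP=> /DxE; apply.
have -> : [set p in upairs [set: T] | class_pair p == [set D; E]] =
          [set [set z.1; z.2] | z in setX D E].
  apply/setP=> p; rewrite inE; apply/andP/imsetP.
    case=> /upairsP[x [y [_ _ xy ->]]] /eqP; rewrite class_pair2 => clE.
    have nxy : pblock P x != pblock P y.
      apply: contraNneq DE => e; move: clE; rewrite e setUid => clE.
      by have := cards2 D E; rewrite -clE cards1; case: eqP.
    case: (set2_eq nxy clE) => -[xE yE].
      by exists (x, y); rewrite // inE /= -xE -yE !in_pblock.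
    by exists (y, x); rewrite /= 1?setUC // inE /= -xE -yE !in_pblock.
  case=> -[x y] /setXP[/= xD yE ->].
  rewrite class_pair2 (pblockE DP xD) (pblockE EP yE) eqxx; split=> //.
  by apply: upairs_set2; rewrite ?inE ?(DxEneq x y).
rewrite card_in_imset ?cardsX ?hPc // => -[x y] [x' y'] /setXP[/= xD yE].
move=> /setXP[/= x'D y'E] e.
case: (set2_eq (DxEneq x y xD yE) e) => -[ex ey]; first by rewrite ex ey.
by case: (DxE x); rewrite // ex.
Qed.

Lemma card_pairs_over (O : {set {set {set T}}}) : O \subset upairs P ->
  #|[set p in upairs [set: T] | class_pair p \in O]| = #|O| * c ^ 2.
Proof.
move=> OP; rewrite -sum1_card (partition_big class_pair (mem O)) => [|p] /=.
  rewrite -sum_nat_const; apply: eq_bigr => q qO.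
  rewrite -(card_pairs_over_class_pair (subsetP OP q qO)) -sum1_card.
  apply: eq_bigl => p; rewrite !inE -!andbA; do 2!congr (_ && _).
  by apply: andb_idl => /eqP->.
by rewrite inE => /andP[].
Qed.

Variable G : {group {perm T}}.
Hypothesis hGP : [acts G, on P | 'P^*].

Let K := partition_group G P.

Let pblock_perm g x : g \in G -> pblock P (g x) = g @: pblock P x.
Proof.
move=> gG; have xP : pblock P x \in P.
  by apply: pblock_mem; rewrite (cover_partition hP) inE.
by apply: pblockE; rewrite ?imset_f // -setactPE (acts_act hGP).
Qed.

(** Equivariance of [class_pair]: it lets a [K]-invariant family of class pairs pull back to a
    [G]-invariant family of point pairs. *)
Lemma class_pair_perm g : g \in G ->
  exists2 h, h \in K & forall p : {set T}, class_pair (g @: p) = h @: class_pair p.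
Proof.
move=> gG; have [h hK hE] := partition_groupP hGP gG; exists h => // p.
rewrite /class_pair -!imset_comp; apply: eq_imset => x /=.
by rewrite pblock_perm // hE // pblock_mem // (cover_partition hP) inE.
Qed.

Lemma acts_pairs_over (O : {set {set {set T}}}) : [acts K, on O | 'P^*] ->
  [acts G, on [set p in upairs [set: T] | class_pair p \in O] | 'P^*].
Proof.
move=> actO; apply/actsP=> g gG p /=.
rewrite !inE !subsetT setactPE card_imset; last exact: perm_inj.
have [h hK ->] := class_pair_perm gG.
by rewrite -setactPE (acts_act actO).
Qed.

Lemma partition_group_orbit_sub q : q \in upairs P ->
  orbit 'P^* K q \subset upairs P.
Proof.
rewrite inE => /andP[/subsetP qP q2]; apply/subsetP=> _ /orbitP[h hK <-].
rewrite inE card_setact q2 andbT; apply/subsetP=> _ /imsetP[D /qP DP ->].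
have /morphimP[u _ _ ->] := hK.
by rewrite /= apermE (perm_closed _ (restr_perm_on P u)).
Qed.

Variables (B : {set {set T}}) (v k lambda : nat) (b : {set T}).
Hypotheses (hD : two_design B v k lambda) (lam_gt0 : 0 < lambda)
  (hGB : [transitive G, on B | 'P^*]) (bB : b \in B) (c_gt0 : 0 < c).

Lemma partition_group_transitive : k < v ->
  forall D E, D \in P -> E \in P -> exists2 h, h \in K & E = h D.
Proof.
move=> ltkv D E DP EP.
have inh A : A \in P -> exists x, x \in A.
  by move=> AP; apply/card_gt0P; rewrite hPc.
have [x xD] := inh D DP; have [y yE] := inh E EP.
have [g gG yx] := block_transitive_imp_point_transitive hD hGB lam_gt0 ltkv x y.
have [h hK hE] := partition_groupP hGP gG; exists h => //.
by rewrite hE // -(pblockE DP xD) -pblock_perm // -yx (pblockE EP yE).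
Qed.

(* Double counting gives s (cd - 1) = e c 'C(k, 2) for the number s of pairs of
   b over O, where e = 2 |O| / d is an integer by transitivity; as c is coprime
   to cd - 1, it divides s. *)
Lemma pairs_over_orbit_geq (O : {set {set {set T}}}) :
    O \subset upairs P -> [acts K, on O | 'P^*] -> 0 < #|O| ->
  c <= #|[set p in upairs b | class_pair p \in O]|.
Proof.
move=> OP actO O_gt0.
have -> : [set p in upairs b | class_pair p \in O] =
    [set p in [set p in upairs [set: T] | class_pair p \in O] | p \subset b].
  apply/setP=> p; rewrite !inE subsetT /=.
  by rewrite andbC andbA [LHS]andbC -!andbA; do 2?[congr (_ && _)]; rewrite // andbC.
set F := [set p in upairs [set: T] | _].
have FU : F \subset upairs [set: T] by apply/subsetP=> p; rewrite inE => /andP[].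
have cntF := double_count hD hGB FU (acts_pairs_over actO) bB.
have cntT : 'C(v, 2) * lambda = #|B| * 'C(k, 2).
  have actU : [acts G, on upairs [set: T] | 'P^*].
    by apply/actsP=> g gG p /=; rewrite !inE !subsetT card_setact.
  have := double_count hD hGB (subxx _) actU bB.
  rewrite card_upairs cardsT (design_points hD) => ->; congr (_ * _).
  rewrite -(design_blocks hD bB) -card_upairs.
  by apply: eq_card => p; rewrite !inE subsetT andbC.
move: cntF; rewrite card_pairs_over //; set s := #|[set p in F | _]| => cntF.
have cardP : v = c * #|P|.
  rewrite -(design_points hD) -cardsT (card_partition hP) mulnC.
  by rewrite (eq_bigr (fun=> c)) ?sum_nat_const.
(* When [v <= k] the block is the whole point set, and [s] is simply [#|O| * c ^ 2]. *)
have [ltkv|levk] := ltnP k v; last first.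
  have bT : b = [set: T].
    apply/eqP; rewrite eqEcard subsetT cardsT (design_points hD).
    by rewrite (design_blocks hD bB).
  have -> : s = #|O| * c ^ 2.
    rewrite -card_pairs_over //; apply: eq_card => p.
    by rewrite [in LHS]inE bT subsetT andbT.
  by nia.
have s_gt0 : 0 < s.
  have : 0 < #|O| * c ^ 2 * lambda by rewrite !muln_gt0 O_gt0 c_gt0.
  by rewrite cntF muln_gt0 => /andP[].
have trK := partition_group_transitive ltkv.
have /dvdnP[e eO] := dvdn_card_invariant_pairs trK OP actO.
apply: dvdn_leq s_gt0 _.
have v_gt0 : 0 < v by lia.
have B_gt0 : 0 < #|B| by apply/card_gt0P; exists b.
have P_gt0 : 0 < #|P| by move: v_gt0; rewrite cardP muln_gt0 => /andP[].
have cop : coprime c v.-1.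
  by have := coprimenP v_gt0; rewrite {1}cardP coprimeMl => /andP[].
rewrite -(Gauss_dvdl s cop).
apply/dvdnP; exists (e * 'C(k, 2)).
have binv : v * v.-1 = 2 * 'C(v, 2) by have := mul_bin_diag v 1; rewrite bin1; lia.
(* Eliminate [lambda] and [#|B|] between the double counts for [F] and for all pairs. *)
have key : s * 'C(v, 2) = #|O| * c ^ 2 * 'C(k, 2).
  apply/eqP; rewrite -(@eqn_pmul2l (#|B| * lambda)) ?muln_gt0 ?B_gt0 //; apply/eqP.
  rewrite mulnACA [lambda * _]mulnC.
  by rewrite -cntF cntT; lia.
apply/eqP; rewrite -(@eqn_pmul2l v) //; apply/eqP.
rewrite mulnCA binv mulnCA key !mulnA eO cardP; lia.
Qed.

(** Sort the pairs of [b] lying over two distinct classes by the [K]-orbit of their class pair; each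
    orbit receives at least [c] of them by [pairs_over_orbit_geq]. *)
Lemma partition_pair_rank_leq : pair_rank K P * c <= #|outer_pairs P b|.
Proof.
pose h p := orbit 'P^* K (class_pair p).
rewrite /pair_rank -sum_nat_const.
pose U := [set p in upairs b | class_pair p \in upairs P].
apply: (@leq_trans #|U|); last first.
  apply/subset_leq_card/subsetP=> p; rewrite inE => /andP[].
  exact: class_pair_outer.
rewrite -sum1_card (partition_big h (mem (orbit 'P^* K @: upairs P))) /=; last first.
  by move=> p; rewrite inE => /andP[_ pP]; apply: imset_f.
apply: leq_sum => _ /imsetP[q qP ->].
have OP := partition_group_orbit_sub qP.
have actO : [acts K, on orbit 'P^* K q | 'P^*] by apply: acts_orbit; apply: subsetT.
have O_gt0 : 0 < #|orbit 'P^* K q| by apply/card_gt0P; exists q; apply: orbit_refl.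
apply: leq_trans (pairs_over_orbit_geq OP actO O_gt0) _; rewrite -sum1_card.
rewrite [leqLHS](eq_bigl (fun p => (p \in U) && (h p == orbit 'P^* K q))) // => p.
rewrite inE [p \in U]inE -andbA; congr (_ && _).
apply/idP/andP => [pq|[_ /eqP <-]]; last exact: orbit_refl.
by split; [exact: (subsetP OP) | exact/eqP/orbit_eqP].
Qed.

End ClassPairs.

Theorem theorem1p3 (T : finType) (B : {set {set T}}) (v k lambda : nat)
    (hD : two_design B v k lambda)
    (G : {group {perm T}}) (hG : G \subset design_aut B)
    (hGB : [transitive G, on B | 'P^*])
    (c d : nat) (hc : 2 <= c) (hd : 2 <= d) (hv : v = (c * d)%N)
    (P : {set {set T}}) (hP : partition P [set: T]) (hPd : #|P| = d)
    (hPc : forall D : {set T}, D \in P -> #|D| = c)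
    (hGP : [acts G, on P | 'P^*])
    (m n : nat) (hmn : DD_parameters B P k c d m n)
    (C : {set T}) (hC : C \in P)
    (alpha : T) (halpha : alpha \in C)
    (Delta : {set T}) (hDelta : Delta \in P) :
  let H := class_group G C in
  let K := partition_group G P in
  (((perm_rank H C alpha)%:R - 1) / 2%:R <= (pair_rank H C)%:R :> rat)%R /\
  pair_rank H C <= n /\
  (((perm_rank K P Delta)%:R - 1) / 2%:R <= (pair_rank K P)%:R :> rat)%R /\
  pair_rank K P <= m.
Proof.
move=> H K; have [b bB _] := imsetP hGB.
have rat_rank (r p : nat) : r <= (2 * p).+1 -> ((r%:R - 1) / 2%:R <= p%:R :> rat)%R.
  move=> le_rp; rewrite Num.Theory.ler_pdivrMr ?Num.Theory.ltr0n //.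
  rewrite Num.Theory.lerBlDr -GRing.natrM GRing.natr1 Num.Theory.ler_nat.
  by rewrite mulnC.
(* Since [n] is positive, [b] contains a pair of distinct points, and the blocks through these two
   points include [b]. *)
have lam_gt0 : 0 < lambda.
  have : 0 < #|inner_pairs P b| by rewrite (DD_inner hmn bB) (DD_n_gt0 hmn).
  case/card_gt0P=> p; rewrite inE => /andP[/upairsP[x [y [xb yb xy _]]] _].
  by rewrite -(design_pairs hD xy); apply/card_gt0P; exists b; rewrite inE bB xb yb.
split; first exact/rat_rank/perm_rank_leq.
split.
  rewrite -(DD_inner hmn bB).
  exact: class_pair_rank_leq hD lam_gt0 hGB hP hGP hC bB.
split; first exact/rat_rank/perm_rank_leq.
have c_gt0 : 0 < c by apply: leq_trans hc.
rewrite -(leq_pmul2r c_gt0) -(DD_outer hmn bB).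
exact: (partition_pair_rank_leq hP hPc hGP hD lam_gt0 hGB bB c_gt0).
Qed.
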